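(* $\mathrm{P}$ and $\mathrm{Q}$ can be eliminated from the equations arising from the discrete Clebsch variational principle $$\delta\sum_{n=1}^N\left(l(\mathrm{X}^{n-1})+\left\langle \mathrm{P}^{n-1},\frac1{\Delta t}\mathrm{Q}^{n-1}\,\overline{\log}\big((\mathrm{Q}^{n-1})^{-1}\mathrm{Q}^n\big)-\mathrm{Q}^{n-1}\mathrm{X}^{n-1}\right\rangle\right)=0$$ to obtain the equation $$0=\big(\overline{\exp}(\Delta t\mathrm{X}^{n-1})\big)^\dagger\,\big(T_{\overline{\exp}(\Delta t\mathrm{X}^{n-1})}\overline{\log}\big)^\dagger\frac{\delta l}{\delta\mathrm{X}}(\mathrm{X}^{n-1})-\big(T_{\overline{\exp}(\Delta t\mathrm{X}^{n})}\overline{\log}\big)^\dagger\frac{\delta l}{\delta\mathrm{X}}(\mathrm{X}^{n})\,\big(\overline{\exp}(\Delta t\mathrm{X}^n)\big).$$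
   Context: Setting: matrix groups. The group elements $\mathrm{Q}^n$ are $d$-dimensional (i.e. $d\times d$) complex matrices; $V$ is the vector space of matrices $\mathrm{X}$ acting through the velocity map $\mathcal{L}_{\mathrm{X}}\mathrm{Q}=\mathrm{Q}\mathrm{X}$ (right matrix multiplication), for example $V=\mathfrak{so}(3)$ acting on $SO(3)$. The $\mathrm{P}^n$ are Lagrange multipliers, $l$ is a given functional on $V$, and $\Delta t$ is the time step. $\dagger$ denotes the transpose-conjugate. The inner product is $\langle\mathrm{P},\dot{\mathrm{Q}}\rangle=\mathrm{Tr}(\mathrm{P}\dot{\mathrm{Q}}^\dagger)=\sum_{kl}P_{kl}\overline{\dot Q_{kl}}$; in the variational principle it is taken at the point $\mathrm{Q}^{n-1}$. The variational derivative is defined by $\delta l=\langle\frac{\delta l}{\delta\mathrm{X}},\delta\mathrm{X}\rangle$. The exponential map is the solution of $\frac{d}{dt}\exp(t\mathrm{X})=\exp(t\mathrm{X})\mathrm{X}$, $\exp(0)=\mathrm{Id}$, and the logarithm is defined by $\log(\exp(\mathrm{X}))=\mathrm{X}$ for $\mathrm{X}\in V$. $\overline{\log}:\Omega\to V$, with $\Omega$ its domain of group elements, is an approximate logarithm: $\overline{\log}(A)=\log(A)+\mathcal{O}((A-I)^p)$ for some positive integer $p$, where $I$ is the identity; $\overline{\exp}$ is the inverse of $\overline{\log}$. $T_A\overline{\log}$ is the tangent (derivative) of $\overline{\log}$ at $A$, a linear operator on matrices, and $(T_A\overline{\log})^\dagger$ is its adjoint; in the equation it acts on the matrix $\frac{\delta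 l}{\delta\mathrm{X}}$ immediately to its right.
   Formalization: The last factor is corrected to the transpose-conjugate of exp-bar(Δt X^n); the equation is proved paired with every element of V (interior n, fixed end points), and as a literal matrix equation only when the group is unitary or V spans all matrices over C, since it fails e.g. for SL(2,R). *)

(* Defs.v *)
From HB Require Import structures.
From mathcomp Require Export all_boot all_order all_algebra.
From mathcomp Require Export complex.
From mathcomp Require Export all_classical all_reals all_analysis.

Set Implicit Arguments.
Unset Strict Implicit.
Unset Printing Implicit Defensive.

Export Order.TTheory GRing.Theory Num.Theory.
Export numFieldNormedType.Exports.

Global Open Scope classical_set_scope.
Global Open Scope ring_scope.
Global Open Scope complex_scope.
Global Open Scope sesquilinear_scope.

(* Antilinear in the second argument. *)
Definition inner (R : realType) (d : nat) (P W : 'M[R[i]]_d) : R[i] :=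
  \tr (P *m W^t*).

Definition mxnorm (R : realType) (d : nat) (A : 'M[R[i]]_d) : R :=
  Num.sqrt (complex.Re (inner A A)).

(* Derivatives with respect to a real parameter, taken on real and imaginary
   parts, and entrywise for matrices. *)
Definition has_deriv (R : realType) (f : R -> R[i]) (t : R) (v : R[i]) : Prop :=
  is_derive t 1 (fun s => complex.Re (f s)) (complex.Re v) /\
  is_derive t 1 (fun s => complex.Im (f s)) (complex.Im v).

Definition has_mxderiv (R : realType) (d : nat)
    (f : R -> 'M[R[i]]_d) (t : R) (D : 'M[R[i]]_d) : Prop :=
  forall i j, has_deriv (fun s => f s i j) t (D i j).

Definition matrix_group (R : realType) (d : nat) (G : set 'M[R[i]]_d) : Prop :=
  [/\ G 1%:M,
      forall A, G A -> A \in unitmx,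
      forall A B, G A -> G B -> G (A *m B) &
      forall A, G A -> G (invmx A)].

(* The vector space V: velocities at the identity of curves in G.  It is a real
   vector space, in general not a complex one. *)
Definition lie_algebra (R : realType) (d : nat) (G : set 'M[R[i]]_d) :
    set 'M[R[i]]_d :=
  [set Y | exists g : R -> 'M[R[i]]_d,
     [/\ forall t, G (g t), g 0 = 1%:M & has_mxderiv g 0 Y]].

(* The tangent space at A, i.e. the image of V under the velocity map
   X |-> A X. *)
Definition tangent_space (R : realType) (d : nat) (G : set 'M[R[i]]_d)
    (A : 'M[R[i]]_d) : set 'M[R[i]]_d :=
  [set A *m Y | Y in lie_algebra G].

(* The complex span of a real vector space: the complex inner product space
   in which elements dual to V are represented. *)
Definition cspan (R : realType) (d : nat) (V : set 'M[R[i]]_d) :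
    set 'M[R[i]]_d :=
  [set Z | exists Y1 Y2, [/\ V Y1, V Y2 & Z = Y1 + 'i%C *: Y2]].

Definition is_mxexp (R : realType) (d : nat)
    (mexp : 'M[R[i]]_d -> 'M[R[i]]_d) : Prop :=
  mexp 0 = 1%:M /\
  forall X t, has_mxderiv (fun s => mexp (s%:C *: X)) t (mexp (t%:C *: X) *m X).

(* The identity log (exp X) = X is only asked for small X in V: exp is not
   injective on, e.g., so(3), so that it cannot hold for all X in V. *)
Definition is_mxlog (R : realType) (d : nat) (V : set 'M[R[i]]_d)
    (mexp mlog : 'M[R[i]]_d -> 'M[R[i]]_d) : Prop :=
  exists2 r : R, 0 < r &
    forall X, V X -> mxnorm X < r -> mlog (mexp X) = X.

(* Om is a neighbourhood of the identity, open in G, logbar maps Om to V, and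
   logbar A = mlog A + O((A - I)^p) as A -> I. *)
Definition is_approx_log (R : realType) (d : nat) (G Om : set 'M[R[i]]_d)
    (mlog logbar : 'M[R[i]]_d -> 'M[R[i]]_d) (p : nat) : Prop :=
  [/\ Om `<=` G, Om 1%:M,
      forall A, Om A ->
        exists2 r : R, 0 < r & forall B, G B -> mxnorm (B - A) < r -> Om B,
      forall A, Om A -> lie_algebra G (logbar A) &
      exists (K r : R), 0 < r /\ forall A, Om A -> mxnorm (A - 1%:M) < r ->
        mxnorm (logbar A - mlog A) <= K * mxnorm (A - 1%:M) ^+ p].

(* T A is the tangent map T_A G -> V of f : Om -> V at A; it is only
   constrained on T_A G. *)
Definition is_tangent_map (R : realType) (d : nat) (G Om : set 'M[R[i]]_d)
    (f : 'M[R[i]]_d -> 'M[R[i]]_d)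
    (T : 'M[R[i]]_d -> 'M[R[i]]_d -> 'M[R[i]]_d) : Prop :=
  forall A, Om A ->
  [/\ forall H, tangent_space G A H -> lie_algebra G (T A H),
      forall (a : R) H K, tangent_space G A H -> tangent_space G A K ->
        T A (a%:C *: H + K) = a%:C *: T A H + T A K &
      forall (g : R -> 'M[R[i]]_d) H,
        (forall t, G (g t)) -> g 0 = A -> has_mxderiv g 0 H ->
        has_mxderiv (f \o g) 0 (T A H)].

(* Tadj A is the adjoint of T A : T_A G -> V.  As the pairing is complex, the
   adjoint goes from cspan V to A (cspan V); these are V and T_A G themselves
   when V is a complex space, such as gl(d,C). *)
Definition is_adjoint_map (R : realType) (d : nat) (G Om : set 'M[R[i]]_d)
    (T Tadj : 'M[R[i]]_d -> 'M[R[i]]_d -> 'M[R[i]]_d) : Prop :=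
  forall A W, Om A -> cspan (lie_algebra G) W ->
  (exists2 Z, cspan (lie_algebra G) Z & Tadj A W = A *m Z) /\
  forall H, tangent_space G A H -> inner (Tadj A W) H = inner W (T A H).

(* delta l = <dl, delta X>. *)
Definition is_var_deriv (R : realType) (d : nat) (V : set 'M[R[i]]_d)
    (l : 'M[R[i]]_d -> R[i]) (dl : 'M[R[i]]_d -> 'M[R[i]]_d) : Prop :=
  forall X, V X -> cspan V (dl X) /\
    forall dX, V dX ->
      has_deriv (fun e : R => l (X + e%:C *: dX)) 0 (inner (dl X) dX).

Definition clebsch_action (R : realType) (d N : nat) (dt : R)
    (l : 'M[R[i]]_d -> R[i]) (logbar : 'M[R[i]]_d -> 'M[R[i]]_d)
    (X P Q : nat -> 'M[R[i]]_d) : R[i] :=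
  \sum_(1 <= n < N.+1)
    (l (X n.-1) +
     inner (P n.-1)
       ((dt^-1)%:C *: (Q n.-1 *m logbar (invmx (Q n.-1) *m Q n))
        - Q n.-1 *m X n.-1)).

(* X^0..X^(N-1) in V, P^0..P^(N-1) arbitrary, Q^0..Q^N in G. *)
Definition admissible (R : realType) (d N : nat) (G Om : set 'M[R[i]]_d)
    (X Q : nat -> 'M[R[i]]_d) : Prop :=
  [/\ forall n, (n < N)%N -> lie_algebra G (X n),
      forall n, (n <= N)%N -> G (Q n) &
      forall n, (n < N)%N -> Om (invmx (Q n) *m Q n.+1)].

(* X varies in V, the multipliers P vary freely, and Q varies along curves in
   G with fixed end points Q^0 and Q^N. *)
Definition stationary (R : realType) (d N : nat) (G : set 'M[R[i]]_d)
    (S : (nat -> 'M[R[i]]_d) -> (nat -> 'M[R[i]]_d) -> (nat -> 'M[R[i]]_d) ->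
         R[i])
    (X P Q : nat -> 'M[R[i]]_d) : Prop :=
  forall (dX dP dQ : nat -> 'M[R[i]]_d) (q : R -> nat -> 'M[R[i]]_d),
    (forall n, (n < N)%N -> lie_algebra G (dX n)) ->
    (forall e n, (n <= N)%N -> G (q e n)) ->
    q 0 = Q ->
    (forall n, (n <= N)%N -> has_mxderiv (fun e => q e n) 0 (dQ n)) ->
    (forall e, q e 0%N = Q 0%N /\ q e N = Q N) ->
    has_deriv (fun e : R => S (fun n => X n + e%:C *: dX n)
                              (fun n => P n + e%:C *: dP n)
                              (q e)) 0 0.

(* The right-hand side of the equation at steps n-1 and n, for Xm = X^(n-1) and
   Xn = X^n.  The last factor carries a conjugate transpose: the adjoint of right
   multiplication by A is right multiplication by A^t*. *)
Definition clebsch_residual (R : realType) (d : nat) (dt : R)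
    (expbar : 'M[R[i]]_d -> 'M[R[i]]_d)
    (Tadj : 'M[R[i]]_d -> 'M[R[i]]_d -> 'M[R[i]]_d)
    (dl : 'M[R[i]]_d -> 'M[R[i]]_d) (Xm Xn : 'M[R[i]]_d) : 'M[R[i]]_d :=
  (expbar (dt%:C *: Xm))^t* *m Tadj (expbar (dt%:C *: Xm)) (dl Xm)
  - Tadj (expbar (dt%:C *: Xn)) (dl Xn) *m (expbar (dt%:C *: Xn))^t*.

(* Main.v *)
Require Import Defs.
From mathcomp Require Import perm ring.

(* Write A_m = (Q_m)^-1 Q_(m+1).  Varying P shows that logbar A_m = dt X_m, i.e.
   A_m = expbar (dt X_m).  Varying X identifies dl(X_m) with (Q_m)^* P_m as a
   functional on the Lie algebra V.  Varying Q_n along Q_n g(e), with g(0) = 1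
   and g'(0) = Y, moves A_(n-1) with velocity A_(n-1) Y and A_n with velocity
   - Y A_n; since the tangent maps of logbar take values in V, the multipliers
   can be replaced by dl, and taking adjoints gives <residual, Y> = 0 for all Y
   in V.  The residual therefore vanishes as soon as it lies in the complex span
   of V.  When G is unitary, A^* = A^-1 turns its two terms into Z_(n-1) and
   A_n Z_n A_n^-1 with Z_(n-1), Z_n in this span, which is stable under
   conjugation by G. *)

Set Implicit Arguments.
Unset Strict Implicit.
Unset Printing Implicit Defensive.

(** * Real and imaginary parts of complex arithmetic *)

Lemma ReD (R : realType) (x y : R[i]) :
  complex.Re (x + y) = complex.Re x + complex.Re y.
Proof. by case: x => a b; case: y. Qed.

Lemma ImD (R : realType) (x y : R[i]) :
  complex.Im (x + y) = complex.Im x + complex.Im y.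
Proof. by case: x => a b; case: y. Qed.

Lemma ReM (R : realType) (x y : R[i]) :
  complex.Re (x * y) =
    complex.Re x * complex.Re y - complex.Im x * complex.Im y.
Proof. by case: x => a b; case: y. Qed.

Lemma ImM (R : realType) (x y : R[i]) :
  complex.Im (x * y) =
    complex.Re x * complex.Im y + complex.Im x * complex.Re y.
Proof. by case: x => a b; case: y. Qed.

Lemma ReV (R : realType) (x : R[i]) :
  complex.Re x^-1 =
    complex.Re x * (complex.Re x * complex.Re x
                    + complex.Im x * complex.Im x)^-1.
Proof. by case: x. Qed.

Lemma ImV (R : realType) (x : R[i]) :
  complex.Im x^-1 =
    - (complex.Im x * (complex.Re x * complex.Re x
                       + complex.Im x * complex.Im x)^-1).
Proof. by case: x. Qed.

Lemma complex_ext (R : realType) (x y : R[i]) :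
  complex.Re x = complex.Re y -> complex.Im x = complex.Im y -> x = y.
Proof. by case: x => a b; case: y => c e /= -> ->. Qed.

(** * Calculus of complex-valued functions of a real parameter *)

Section HasDeriv.
Variable R : realType.
Implicit Types (f g : R -> R[i]) (u v : R[i]) (t : R).

Lemma has_deriv_unique f t u v : has_deriv f t u -> has_deriv f t v -> u = v.
Proof.
move=> [ru iu] [rv iv]; apply: complex_ext.
  by rewrite -(@derive_val _ _ _ _ _ _ _ ru) -(@derive_val _ _ _ _ _ _ _ rv).
by rewrite -(@derive_val _ _ _ _ _ _ _ iu) -(@derive_val _ _ _ _ _ _ _ iv).
Qed.

Lemma has_deriv_cst (c : R[i]) t : has_deriv (fun=> c) t 0.
Proof. by split; exact: is_derive_cst. Qed.

Lemma has_deriv_id t : has_deriv (fun s => s%:C) t 1.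
Proof. by split; [exact: is_derive_id | exact: is_derive_cst]. Qed.

Lemma has_derivD f g t u v : has_deriv f t u -> has_deriv g t v ->
  has_deriv (fun s => f s + g s) t (u + v).
Proof.
move=> [ru iu] [rv iv]; split.
  rewrite ReD (_ : (fun s => _) =
    (fun s => complex.Re (f s)) + (fun s => complex.Re (g s))).
    exact: is_deriveD.
  by apply: funext => s; rewrite ReD.
rewrite ImD (_ : (fun s => _) =
  (fun s => complex.Im (f s)) + (fun s => complex.Im (g s))).
  exact: is_deriveD.
by apply: funext => s; rewrite ImD.
Qed.

Lemma has_derivM f g t u v : has_deriv f t u -> has_deriv g t v ->
  has_deriv (fun s => f s * g s) t (f t * v + u * g t).
Proof.
move=> [ru iu] [rv iv].
split.
  rewrite (_ : (fun s => _) =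
    (fun s => complex.Re (f s)) * (fun s => complex.Re (g s)) -
    (fun s => complex.Im (f s)) * (fun s => complex.Im (g s))); last first.
    by apply: funext => s; rewrite ReM.
  eapply is_derive_eq.
    exact: (is_deriveB (is_deriveM ru rv) (is_deriveM iu iv)).
  rewrite ReD !ReM /GRing.scale /=; ring.
rewrite (_ : (fun s => _) =
  (fun s => complex.Re (f s)) * (fun s => complex.Im (g s)) +
  (fun s => complex.Im (f s)) * (fun s => complex.Re (g s))); last first.
  by apply: funext => s; rewrite ImM.
eapply is_derive_eq.
  exact: (is_deriveD (is_deriveM ru iv) (is_deriveM iu rv)).
rewrite ImD !ImM /GRing.scale /=; ring.
Qed.

Lemma has_derivZ f t u (c : R[i]) : has_deriv f t u ->
  has_deriv (fun s => c * f s) t (c * u).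
Proof.
by move=> df; move: (has_derivM (has_deriv_cst c t) df); rewrite mul0r addr0.
Qed.

Lemma has_deriv_conj f t u : has_deriv f t u ->
  has_deriv (fun s => (f s)^*%R) t u^*%R.
Proof.
have reJ (z : R[i]) : complex.Re z^*%R = complex.Re z by case: z.
have imJ (z : R[i]) : complex.Im z^*%R = - complex.Im z by case: z.
move=> [ru iu]; split; rewrite ?reJ ?imJ.
  by under eq_fun do rewrite reJ.
by under eq_fun do rewrite imJ; exact: is_deriveN.
Qed.

Lemma has_deriv_sum (I : Type) (r : seq I) (F : I -> R -> R[i])
    (D : I -> R[i]) t :
  (forall i, has_deriv (F i) t (D i)) ->
  has_deriv (fun s => \sum_(i <- r) F i s) t (\sum_(i <- r) D i).
Proof.
move=> dF; elim: r => [|i r IH].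
  by rewrite big_nil; under eq_fun do rewrite big_nil; exact: has_deriv_cst.
by rewrite big_cons; under eq_fun do rewrite big_cons; exact: has_derivD.
Qed.

(** Differentiability without a value, for determinants and cofactors, whose derivatives never have
    to be written out. *)
Definition ex_deriv f t := exists v, has_deriv f t v.

Lemma ex_deriv_prod (I : Type) (r : seq I) (F : I -> R -> R[i]) t :
  (forall i, ex_deriv (F i) t) -> ex_deriv (fun s => \prod_(i <- r) F i s) t.
Proof.
move=> dF; elim: r => [|i r [v dr]].
  by exists 0; under eq_fun do rewrite big_nil; exact: has_deriv_cst.
have [u di] := dF i; eexists; under eq_fun do rewrite big_cons.
exact: has_derivM di dr.
Qed.

Lemma ex_derivV f t : f t != 0 -> ex_deriv f t ->
  ex_deriv (fun s => (f s)^-1) t.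
Proof.
move=> ft0 [u [ru iu]].
(* The squared modulus of [f]: the inverse is the conjugate divided by [n]. *)
pose n := (fun s => complex.Re (f s)) * (fun s => complex.Re (f s)) +
  (fun s => complex.Im (f s)) * (fun s => complex.Im (f s)).
have nt0 : n t != 0.
  rewrite (_ : n t = complex.Re (f t) ^+ 2 + complex.Im (f t) ^+ 2) //.
  apply: contra ft0; rewrite paddr_eq0 ?sqr_ge0 // !sqrf_eq0.
  by rewrite eq_complex.
have nV := is_deriveV nt0 (is_deriveD (is_deriveM ru ru) (is_deriveM iu iu)).
have dre := is_deriveM ru nV; have dim := is_deriveN (is_deriveM iu nV).
eexists (Complex _ _); split => /=.
  rewrite (_ : (fun s => _) =
    (fun s => complex.Re (f s)) * (fun s => (n s)^-1)); first exact: dre.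
  by apply: funext => s; rewrite ReV.
rewrite (_ : (fun s => _) =
  - ((fun s => complex.Im (f s)) * (fun s => (n s)^-1))); first exact: dim.
by apply: funext => s; rewrite ImV.
Qed.

End HasDeriv.

(** * Calculus of matrix-valued curves *)

Section HasMxDeriv.
Variables (R : realType) (d : nat).
Implicit Types (f g : R -> 'M[R[i]]_d) (A B D : 'M[R[i]]_d) (t : R).

Lemma has_mxderiv_unique f t A B :
  has_mxderiv f t A -> has_mxderiv f t B -> A = B.
Proof.
move=> dA dB; apply/matrixP => i j.
exact: has_deriv_unique (dA i j) (dB i j).
Qed.

Lemma has_mxderiv_cst A t : has_mxderiv (fun=> A) t 0.
Proof. by move=> i j; rewrite mxE; exact: has_deriv_cst. Qed.

Lemma has_mxderivD f g t A B : has_mxderiv f t A -> has_mxderiv g t B ->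
  has_mxderiv (fun s => f s + g s) t (A + B).
Proof.
move=> df dg i j; rewrite mxE; under eq_fun do rewrite mxE.
exact: has_derivD.
Qed.

Lemma has_mxderivZ f t A (c : R[i]) : has_mxderiv f t A ->
  has_mxderiv (fun s => c *: f s) t (c *: A).
Proof.
by move=> df i j; rewrite mxE; under eq_fun do rewrite mxE; exact: has_derivZ.
Qed.

Lemma has_mxderiv_line A D t : has_mxderiv (fun s => A + s%:C *: D) t D.
Proof.
have dline : has_mxderiv (fun s => s%:C *: D) t D.
  move=> i j; under eq_fun do rewrite mxE mulrC.
  by move: (has_derivZ (D i j) (has_deriv_id t)); rewrite mulr1.
by move: (has_mxderivD (has_mxderiv_cst A t) dline); rewrite add0r.
Qed.

Lemma has_mxderivM f g t A B : has_mxderiv f t A -> has_mxderiv g t B ->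
  has_mxderiv (fun s => f s *m g s) t (f t *m B + A *m g t).
Proof.
move=> df dg i j; rewrite !mxE -big_split /=; under eq_fun do rewrite mxE.
by apply: has_deriv_sum => k; exact: has_derivM.
Qed.

Lemma has_mxderivMl f t A B : has_mxderiv f t A ->
  has_mxderiv (fun s => B *m f s) t (B *m A).
Proof.
move=> df; move: (has_mxderivM (has_mxderiv_cst B t) df).
by rewrite mul0mx addr0.
Qed.

Lemma has_mxderivMr f t A B : has_mxderiv f t A ->
  has_mxderiv (fun s => f s *m B) t (A *m B).
Proof.
move=> df; move: (has_mxderivM df (has_mxderiv_cst B t)).
by rewrite mulmx0 add0r.
Qed.

(** By the Leibniz expansion the determinant is a polynomial in the entries. The size [n] is
    independent of [d] because cofactors are minors of size [d.-1]. *)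
Lemma ex_deriv_det n (f : R -> 'M[R[i]]_n) t :
  (forall i j, ex_deriv (fun s => f s i j) t) ->
  ex_deriv (fun s => \det (f s)) t.
Proof.
move=> df.
have dterm (p : {perm 'I_n}) : exists v,
    has_deriv (fun s => (-1) ^+ p * \prod_i f s i (p i)) t v.
  have [v dv] := ex_deriv_prod (index_enum 'I_n) (fun i => df i (p i)).
  by eexists; apply: has_derivZ dv.
by eexists; apply: has_deriv_sum => p; exact: (projT2 (cid (dterm p))).
Qed.

(** Differentiability comes first, from the cofactor formula; only then does the product rule on
    [f s *m invmx (f s) = 1%:M] determine the value. *)
Lemma has_mxderivV f t A :
  (forall s, f s \in unitmx) -> has_mxderiv f t A ->
  has_mxderiv (fun s => invmx (f s)) t (- (invmx (f t) *m A *m invmx (f t))).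
Proof.
move=> fu df.
have ent i j : ex_deriv (fun s => invmx (f s) i j) t.
  have [v dv] : ex_deriv (fun s => (\det (f s))^-1) t.
    apply: ex_derivV; first by move: (fu t); rewrite unitmxE unitfE.
    by apply: ex_deriv_det => k l; exists (A k l).
  (* The indices are swapped because the adjugate is the transposed cofactor matrix. *)
  have [w dw] : ex_deriv (fun s => \det (row' j (col' i (f s)))) t.
    apply: ex_deriv_det => k l; under eq_fun do rewrite !mxE.
    by eexists; exact: df.
  under eq_fun do rewrite /invmx fu !mxE.
  by eexists; apply: has_derivM dv (has_derivZ _ dw).
(* Choice gathers the entrywise derivatives into one matrix, still without a formula. *)
pose B := \matrix_(i, j) projT1 (cid (ent i j)).
have dB : has_mxderiv (fun s => invmx (f s)) t B.
  by move=> i j; rewrite mxE; exact: (projT2 (cid (ent i j))).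
suff -> : - (invmx (f t) *m A *m invmx (f t)) = B by [].
have : f t *m B + A *m invmx (f t) = 0.
  apply: has_mxderiv_unique (has_mxderivM df dB) _.
  under eq_fun do rewrite mulmxV //; exact: has_mxderiv_cst.
move=> /(congr1 (mulmx (invmx (f t)))); rewrite mulmxDr mulKmx // mulmx0 mulmxA.
by move=> /eqP; rewrite addr_eq0 => /eqP ->.
Qed.

(** * The Hermitian inner product of matrices *)

Lemma innerE A B : inner A B = \sum_i \sum_j A i j * (B i j)^*%R.
Proof.
rewrite /inner /mxtrace; apply: eq_bigr => i _; rewrite mxE.
by apply: eq_bigr => j _; rewrite !mxE.
Qed.

Lemma has_deriv_inner f g t A B : has_mxderiv f t A -> has_mxderiv g t B ->
  has_deriv (fun s => inner (f s) (g s)) t (inner (f t) B + inner A (g t)).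
Proof.
move=> df dg; rewrite !innerE -big_split /=.
under eq_fun do rewrite innerE.
apply: has_deriv_sum => i; rewrite -big_split /=; apply: has_deriv_sum => j.
exact/has_derivM/has_deriv_conj.
Qed.

Lemma innerDr A B D : inner A (B + D) = inner A B + inner A D.
Proof. by rewrite /inner linearD /= map_mxD mulmxDr mxtraceD. Qed.

Lemma innerZr A B c : inner A (c *: B) = c^*%R * inner A B.
Proof. by rewrite /inner linearZ /= map_mxZ -scalemxAr mxtraceZ. Qed.

Lemma inner0r A : inner A 0 = 0.
Proof. by rewrite /inner trmx0 map_mx0 mulmx0 mxtrace0. Qed.

Lemma innerNr A B : inner A (- B) = - inner A B.
Proof. by rewrite -scaleN1r innerZr rmorphN1 mulN1r. Qed.

Lemma inner0l A : inner 0 A = 0.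
Proof. by rewrite /inner mul0mx mxtrace0. Qed.

Lemma innerBl A B D : inner (A - B) D = inner A D - inner B D.
Proof. by rewrite /inner mulmxBl raddfB. Qed.

Lemma inner_mulmxl A B D : inner A (B *m D) = inner (B^t* *m A) D.
Proof.
by rewrite /inner trmx_mul map_mxM mulmxA mxtrace_mulC mulmxA.
Qed.

Lemma inner_mulmxr A B D : inner A (B *m D) = inner (A *m D^t*) B.
Proof. by rewrite /inner trmx_mul map_mxM mulmxA. Qed.

(** A sum of squared moduli: nonnegative terms with zero sum vanish, first row by row, then entry by
    entry. *)
Lemma inner_self_eq0 A : inner A A = 0 -> A = 0.
Proof.
rewrite innerE => /eqP; rewrite psumr_eq0; last first.
  by move=> i _; apply: sumr_ge0 => j _; exact: mul_conjC_ge0.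
move=> /allP A0; apply/matrixP => i j; rewrite mxE.
have := A0 i (mem_index_enum _); rewrite psumr_eq0; last first.
  by move=> k _; exact: mul_conjC_ge0.
by move=> /allP /(_ j (mem_index_enum _)); rewrite mul_conjC_eq0 => /eqP.
Qed.

End HasMxDeriv.

(** * The Lie algebra of a matrix group and its complex span *)

Section LieAlgebra.
Variables (R : realType) (d : nat) (G : set 'M[R[i]]_d).
Hypothesis mG : matrix_group G.
Implicit Types A Y Z : 'M[R[i]]_d.

Lemma lie_algebra0 : lie_algebra G 0.
Proof.
have [G1 _ _ _] := mG; exists (fun=> 1%:M).
by split=> //; exact: has_mxderiv_cst.
Qed.

(** The group law does it: if [g] and [h] have velocities [Y1] and [Y2], the curve
    [g s *m invmx (h s)] has velocity [Y1 - Y2] at the identity. *)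
Lemma lie_algebraB Y1 Y2 :
  lie_algebra G Y1 -> lie_algebra G Y2 -> lie_algebra G (Y1 - Y2).
Proof.
have [_ Gu GM GV] := mG.
move=> [g [Gg g0 dg]] [h [Gh h0 dh]].
exists (fun s => g s *m invmx (h s)); split.
- by move=> t; apply: GM => //; exact: GV.
- by rewrite g0 h0 invmx1 mulmx1.
- have := has_mxderivM dg (has_mxderivV (fun s => Gu _ (Gh s)) dh).
  by rewrite g0 h0 invmx1 !mulmx1 !mul1mx addrC.
Qed.

Lemma lie_algebraN Y : lie_algebra G Y -> lie_algebra G (- Y).
Proof.
by move=> VY; rewrite -sub0r; apply: lie_algebraB; first exact: lie_algebra0.
Qed.

Lemma lie_algebra_conj A Y :
  G A -> lie_algebra G Y -> lie_algebra G (A *m Y *m invmx A).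
Proof.
have [_ Gu GM GV] := mG.
move=> GA [g [Gg g0 dg]].
exists (fun s => A *m g s *m invmx A); split.
- by move=> t; apply: (GM); [exact: GM | exact: GV].
- by rewrite g0 mulmx1 mulmxV // Gu.
- exact/has_mxderivMr/has_mxderivMl.
Qed.

Lemma cspan_lie_algebraB Z1 Z2 :
  cspan (lie_algebra G) Z1 -> cspan (lie_algebra G) Z2 ->
  cspan (lie_algebra G) (Z1 - Z2).
Proof.
move=> [U1 [U2 [V1 V2 ->]]] [W1 [W2 [V3 V4 ->]]].
exists (U1 - W1), (U2 - W2); split; [exact: lie_algebraB..|].
by rewrite scalerBr opprD addrACA.
Qed.

Lemma cspan_lie_algebra_conj A Z :
  G A -> cspan (lie_algebra G) Z -> cspan (lie_algebra G) (A *m Z *m invmx A).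
Proof.
move=> GA [Y1 [Y2 [V1 V2 ->]]].
exists (A *m Y1 *m invmx A), (A *m Y2 *m invmx A).
split; [exact: lie_algebra_conj..|].
by rewrite mulmxDr mulmxDl -scalemxAr -scalemxAl.
Qed.

(** Antilinearity in the second argument carries orthogonality from V to its complex span. *)
Lemma inner_cspan_eq0 W Z :
  (forall Y, lie_algebra G Y -> inner W Y = 0) ->
  cspan (lie_algebra G) Z -> inner W Z = 0.
Proof.
by move=> W0 [Y1 [Y2 [V1 V2 ->]]]; rewrite innerDr innerZr !W0 // mulr0 addr0.
Qed.

(** Right translates are tangent as well, since Y A = A (A^-1 Y A) and V is stable under
    conjugation. *)
Lemma tangent_space_mulr A Y :
  G A -> lie_algebra G Y -> tangent_space G A (Y *m A).
Proof.
have [_ Gu _ GV] := mG.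
move=> GA VY; exists (invmx A *m Y *m A).
  by move: (lie_algebra_conj (GV _ GA) VY); rewrite invmxK.
by rewrite !mulmxA mulmxV ?Gu // mul1mx.
Qed.

End LieAlgebra.

(** As 0 is a tangent vector, additivity gives [T A 0 = T A 0 + T A 0]. *)
Lemma tangent_map0 (R : realType) (d : nat) (G Om : set 'M[R[i]]_d)
    (f : 'M[R[i]]_d -> 'M[R[i]]_d) (T : 'M[R[i]]_d -> 'M[R[i]]_d -> 'M[R[i]]_d)
    (A : 'M[R[i]]_d) :
  matrix_group G -> is_tangent_map G Om f T -> Om A -> T A 0 = 0.
Proof.
move=> mG tT /tT [_ TL _].
have ts0 : tangent_space G A 0.
  by exists 0; [exact: lie_algebra0 | rewrite mulmx0].
have := TL 1 0 0 ts0 ts0; rewrite !scale1r addr0 => /esym/eqP.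
by rewrite -[X in _ == X]addr0 (inj_eq (addrI _)) => /eqP.
Qed.

(** * First variation of the Clebsch action and its three families of equations *)

Section FirstVariation.
Variables (R : realType) (d N : nat) (dt : R) (G Om : set 'M[R[i]]_d).
Variables (logbar : 'M[R[i]]_d -> 'M[R[i]]_d).
Variables (T : 'M[R[i]]_d -> 'M[R[i]]_d -> 'M[R[i]]_d).
Variables (l : 'M[R[i]]_d -> R[i]) (dl : 'M[R[i]]_d -> 'M[R[i]]_d).
Variables (X P Q : nat -> 'M[R[i]]_d).
Hypothesis dt0 : 0 < dt.
Hypothesis mG : matrix_group G.
Hypothesis tT : is_tangent_map G Om logbar T.
Hypothesis ldl : is_var_deriv (lie_algebra G) l dl.
Hypothesis adm : admissible N G Om X Q.
Hypothesis stat : stationary N G (clebsch_action N dt l logbar) X P Q.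

Let V := lie_algebra G.
Let A m := invmx (Q m) *m Q m.+1.

Let OA m : (m < N)%N -> Om (A m).
Proof. by have [_ _] := adm; apply. Qed.

Let Qu m : (m <= N)%N -> Q m \in unitmx.
Proof.
by move=> mN; have [_ GQ _] := adm; have [_ Gu _ _] := mG; exact/Gu/GQ.
Qed.

Let dtVC : (dt^-1)%:C * dt%:C = 1.
Proof. by rewrite -(rmorphM (real_complex R)) /= mulVf ?gt_eqF. Qed.

(** The quantity that the multiplier [P m] is paired with in the action. *)
Let constraint m :=
  (dt^-1)%:C *: (Q m *m logbar (A m)) - Q m *m X m.

(** The product and chain rules compute the derivative of the action along an arbitrary variation;
    stationarity gives the value 0, and derivatives are unique. *)
Lemma first_variation (dX dP dQ : nat -> 'M[R[i]]_d)
    (q : R -> nat -> 'M[R[i]]_d) :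
  (forall n, (n < N)%N -> V (dX n)) ->
  (forall e n, (n <= N)%N -> G (q e n)) ->
  q 0 = Q ->
  (forall n, (n <= N)%N -> has_mxderiv (fun e => q e n) 0 (dQ n)) ->
  (forall e, q e 0%N = Q 0%N /\ q e N = Q N) ->
  \sum_(m < N)
    (inner (dl (X m)) (dX m) +
     (inner (P m)
        ((dt^-1)%:C *:
           (Q m *m T (A m) (invmx (Q m) *m dQ m.+1
                            - invmx (Q m) *m dQ m *m A m)
            + dQ m *m logbar (A m))
         - (Q m *m dX m + dQ m *m X m))
      + inner (dP m) (constraint m))) = 0.
Proof.
have [VX _ _] := adm; have [_ Gu GM GV] := mG.
move=> VdX Gq q0 dq qend.
apply: has_deriv_unique (stat dP VdX Gq q0 dq qend).
rewrite /clebsch_action; under eq_fun do rewrite big_add1 /= big_mkord.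
pose S (m : 'I_N) (e : R) := l (X m + e%:C *: dX m) +
  inner (P m + e%:C *: dP m)
    ((dt^-1)%:C *: (q e m *m logbar (invmx (q e m) *m q e m.+1))
     - q e m *m (X m + e%:C *: dX m)).
apply: (@has_deriv_sum _ _ _ S) => m; rewrite /S.
have mN := ltn_ord m; have mN' := ltnW mN.
apply: has_derivD; first by have [_] := ldl (VX _ mN); apply; exact: VdX.
have qm : q 0 m = Q m by rewrite q0.
have qm1 : q 0 m.+1 = Q m.+1 by rewrite q0.
have dinv : has_mxderiv (fun e => invmx (q e m)) 0
    (- (invmx (Q m) *m dQ m *m invmx (Q m))).
  rewrite -qm; apply: has_mxderivV (dq _ mN').
  by move=> e; exact/Gu/Gq.
have dA : has_mxderiv (fun e => invmx (q e m) *m q e m.+1) 0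
    (invmx (Q m) *m dQ m.+1 - invmx (Q m) *m dQ m *m A m).
  have := has_mxderivM dinv (dq _ mN).
  by rewrite qm qm1 mulNmx /A !mulmxA.
have dlog : has_mxderiv (fun e => logbar (invmx (q e m) *m q e m.+1)) 0
    (T (A m) (invmx (Q m) *m dQ m.+1 - invmx (Q m) *m dQ m *m A m)).
  (* The tangent map is characterized along curves in [G], so the increment has to stay in [G] for
     every [e]. *)
  have [_ _ dT] := tT (OA mN).
  apply: (dT _ _ _ _ dA) => [e|]; last by rewrite qm qm1.
  by apply: GM; [exact/GV/Gq | exact: Gq].
have dQlog := has_mxderivZ (dt^-1)%:C (has_mxderivM (dq _ mN') dlog).
have dQX := has_mxderivZ (-1)
  (has_mxderivM (dq _ mN') (has_mxderiv_line (X m) (dX m) 0)).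
have := has_deriv_inner (has_mxderiv_line (P m) (dP m) 0)
  (has_mxderivD dQlog dQX).
rewrite qm qm1 !scale0r !addr0 !scaleN1r.
by under eq_fun do rewrite scaleN1r.
Qed.

(** Only [P m] is varied, in the direction of the constraint itself, so that the first variation is
    the squared norm of the constraint. *)
Lemma stationary_constraint m :
  (m < N)%N -> logbar (A m) = dt%:C *: X m.
Proof.
move=> mN; have [_ GQ _] := adm.
pose dP k := if k == m then constraint m else 0.
have V0 : forall n, (n < N)%N -> V 0 by move=> *; exact: lie_algebra0.
have := @first_variation (fun=> 0) dP (fun=> 0) (fun=> Q) V0
  (fun _ => GQ) erefl (fun n _ => has_mxderiv_cst (Q n) 0)
  (fun=> conj erefl erefl).
rewrite (bigD1 (Ordinal mN)) //= big1 ?addr0; last first.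
  move=> i im; rewrite /dP ifN // !inner0r inner0l.
  rewrite !(mulmx0, mul0mx) subr0 (tangent_map0 mG tT (OA (ltn_ord i))).
  by rewrite !(mulmx0, addr0, scaler0, subr0) inner0r addr0.
rewrite !(mulmx0, mul0mx) subr0 (tangent_map0 mG tT (OA mN)).
rewrite !(mulmx0, addr0, scaler0, subr0) !inner0r !add0r /dP eqxx.
move=> /inner_self_eq0 /eqP; rewrite subr_eq0 => /eqP.
move=> /(congr1 (fun B => dt%:C *: (invmx (Q m) *m B))).
rewrite -scalemxAr !mulKmx ?Qu ?(ltnW mN) // scalerA.
by rewrite mulrC dtVC scale1r.
Qed.

(** Only [X m] is varied; it enters the action through [l] and through the term [- Q m *m X m], and
    the two contributions must balance. *)
Lemma stationary_momentum m Y :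
  (m < N)%N -> V Y -> inner (dl (X m)) Y = inner (P m) (Q m *m Y).
Proof.
move=> mN VY; have [_ GQ _] := adm.
pose dX k := if k == m then Y else 0.
have VdX : forall n, (n < N)%N -> V (dX n).
  by move=> n _; rewrite /dX; case: eqP => // _; exact: lie_algebra0.
have := @first_variation dX (fun=> 0) (fun=> 0) (fun=> Q) VdX
  (fun _ => GQ) erefl (fun n _ => has_mxderiv_cst (Q n) 0)
  (fun=> conj erefl erefl).
rewrite (bigD1 (Ordinal mN)) //= big1 ?addr0; last first.
  move=> i im; rewrite /dX ifN // !inner0r inner0l.
  rewrite !(mulmx0, mul0mx) subr0 (tangent_map0 mG tT (OA (ltn_ord i))).
  by rewrite !(mulmx0, addr0, scaler0, subr0) inner0r addr0.
rewrite !(mulmx0, mul0mx) subr0 (tangent_map0 mG tT (OA mN)) inner0l.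
rewrite !(mulmx0, addr0, scaler0, sub0r) innerNr /dX eqxx.
by move=> /eqP; rewrite subr_eq0 => /eqP.
Qed.

(** The equation from varying [Q m.+1] alone, with [P] already replaced by [dl], so that [Q]
    survives only in the increments [A]. *)
Lemma stationary_group m Y : (m.+1 < N)%N -> V Y ->
  inner (dl (X m)) (T (A m) (A m *m Y)) +
  inner (dl (X m.+1)) (T (A m.+1) (- (Y *m A m.+1))) = 0.
Proof.
move=> mN VY; have [_ GQ _] := adm; have [_ _ GM GV] := mG.
have mN' := ltnW mN.
have GA k : (k < N)%N -> G (A k).
  by move=> kN; apply: GM; [apply: GV|]; apply: GQ => //; exact: ltnW.
have [g [Gg g0 dg]] := VY.
(* Since [m.+1] is neither 0 nor [N], this curve keeps both end points fixed. *)
pose q e k := if k == m.+1 then Q k *m g e else Q k.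
pose dQ k := if k == m.+1 then Q k *m Y else 0.
have V0 : forall n, (n < N)%N -> V 0 by move=> *; exact: lie_algebra0.
have Gq e n : (n <= N)%N -> G (q e n).
  by move=> nN; rewrite /q; case: eqP => _; [apply: GM => //|]; exact: GQ.
have q0 : q 0 = Q.
  by apply: funext => k; rewrite /q g0 mulmx1 if_same.
have dq n : (n <= N)%N -> has_mxderiv (fun e => q e n) 0 (dQ n).
  move=> _; rewrite /q /dQ; case: eqP => _; last exact: has_mxderiv_cst.
  exact: has_mxderivMl.
have qend e : q e 0%N = Q 0%N /\ q e N = Q N.
  by rewrite /q /= ifN // gtn_eqF.
have := @first_variation (fun=> 0) (fun=> 0) dQ q V0 Gq q0 dq qend.
(* [Q m.+1] occurs only in the summands [m.+1] and [m]. *)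
rewrite (bigD1 (Ordinal mN)) //= (bigD1 (Ordinal mN')) /=; last first.
  by rewrite -val_eqE /= ltn_eqF.
rewrite big1 ?[X in _ + X]addr0; last first.
  move=> i /andP [im1 im]; rewrite !inner0r inner0l /dQ eqSS !ifN //.
  rewrite !(mulmx0, mul0mx) subr0 (tangent_map0 mG tT (OA (ltn_ord i))).
  by rewrite !(mulmx0, addr0, scaler0, subr0) inner0r addr0.
rewrite /dQ !eqSS eqxx gtn_eqF // ltn_eqF //.
rewrite !inner0r !inner0l !(mulmx0, mul0mx) subr0 sub0r !add0r !addr0 subr0.
(* In the summand [m.+1] the constraint makes the term with [logbar] cancel the one with [X m.+1].
   What remains has the common nonzero factor [dt^-1], which is divided out. *)
rewrite stationary_constraint // mulKmx ?Qu //.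
rewrite scalerDr -(scalemxAr dt%:C) scalerA dtVC scale1r.
rewrite addrK !innerZr -mulrDr !mulmxA -/(A m) => /eqP.
have [TA _ _] := tT (OA mN'); have [TA1 _ _] := tT (OA mN).
rewrite mulf_eq0 conjC_eq0 fmorph_eq0 invr_eq0 gt_eqF //= => /eqP <-.
(* Both values of [T] lie in V, where pairing with [dl] is pairing with [P]. *)
rewrite addrC !stationary_momentum //.
- by apply: TA; exists Y.
- apply: TA1; rewrite -mulmxA -mulNmx.
  by apply: tangent_space_mulr; [|exact: GA|exact: lie_algebraN].
Qed.

End FirstVariation.

(** * Elimination of the multipliers and the group elements *)

Theorem corollary30 (R : realType) (d N p : nat) (dt : R)
  (G Om : set 'M[R[i]]_d)
  (mexp mlog logbar expbar : 'M[R[i]]_d -> 'M[R[i]]_d)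
  (T Tadj : 'M[R[i]]_d -> 'M[R[i]]_d -> 'M[R[i]]_d)
  (l : 'M[R[i]]_d -> R[i]) (dl : 'M[R[i]]_d -> 'M[R[i]]_d)
  (X P Q : nat -> 'M[R[i]]_d) :
  0 < dt ->
  (0 < p)%N ->
  matrix_group G ->
  is_mxexp mexp ->
  is_mxlog (lie_algebra G) mexp mlog ->
  is_approx_log G Om mlog logbar p ->
  (forall A, Om A -> expbar (logbar A) = A) ->
  is_tangent_map G Om logbar T ->
  is_adjoint_map G Om T Tadj ->
  is_var_deriv (lie_algebra G) l dl ->
  admissible N G Om X Q ->
  stationary N G (clebsch_action N dt l logbar) X P Q ->
  forall n : nat, (0 < n < N)%N ->
    (forall Y, lie_algebra G Y ->
       inner (clebsch_residual dt expbar Tadj dl (X n.-1) (X n)) Y = 0) /\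
    ((forall A, G A -> A \is unitarymx) \/
       cspan (lie_algebra G) = setT ->
     0 = clebsch_residual dt expbar Tadj dl (X n.-1) (X n)).
Proof.
move=> dt0 _ mG _ _ [OG _ _ _ _] expK tT aT ldl adm stat [//|n] /= nN.
have [VX _ OA] := adm; have [_ Gu _ _] := mG.
have nN' := ltnW nN.
have log_eq := stationary_constraint dt0 mG tT ldl adm stat.
(* Applying [expbar] to the constraint expresses each increment through [X k] alone. *)
have exp_eq k : (k < N)%N ->
    expbar (dt%:C *: X k) = invmx (Q k) *m Q k.+1.
  by move=> kN; rewrite -log_eq // expK //; exact: OA.
rewrite /clebsch_residual !exp_eq //.
have := stationary_group dt0 mG tT ldl adm stat nN.
move: (OA _ nN) (OA _ nN'); move: (invmx _ *m _) (invmx _ *m _) => A1 A0 O1 O0.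
have [c0 _] := ldl _ (VX _ nN'); have [c1 _] := ldl _ (VX _ nN).
have [[Z0 cZ0 eZ0] adj0] := aT _ _ O0 c0.
have [[Z1 cZ1 eZ1] adj1] := aT _ _ O1 c1.
move=> stat_n; set res := _ - _.
have res0 Y : lie_algebra G Y -> inner res Y = 0.
  move=> VY; rewrite -(stat_n _ VY) -adj0; last by exists Y.
  rewrite -adj1; last first.
    rewrite -mulNmx.
    by apply: tangent_space_mulr; [|exact: OG|exact: lie_algebraN].
  (* Left multiplication by [A0] and right multiplication by [A1] cross the pairing as [A0^t*] on
     the left and [A1^t*] on the right. *)
  by rewrite innerNr innerBl -inner_mulmxl -inner_mulmxr.
(* It remains to place the residual in the complex span, where it is orthogonal to itself; this is
   immediate if the span is everything. *)
split=> // GV; apply/esym/inner_self_eq0/(inner_cspan_eq0 res0).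
case: GV => [unit|->//].
have tinv B : G B -> B^t* = invmx B.
  move=> GB; rewrite -[LHS](mulKmx (Gu _ GB)) (unitarymxP (unit _ GB)).
  by rewrite mulmx1.
(* With inverses in place of conjugate transposes the residual becomes
   [Z0 - A1 *m Z1 *m invmx A1]. *)
rewrite /res eZ0 eZ1 !tinv; [|exact: OG..].
rewrite mulKmx ?Gu //; last exact: OG.
apply: cspan_lie_algebraB => //.
by apply: cspan_lie_algebra_conj => //; exact: OG.
Qed.
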